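(* For every $d\ge 10$, the $d$-dimensional hypercube contains vertex sets $A$ and $B$ such that, when $\mu_A$ and $\mu_B$ are the uniform probability measures with support $A$ and $B$ respectively, there exists an optimal transportation $\tau:A\times B\to\mathbb{R}_{\ge 0}$ from $\mu_A$ to $\mu_B$ such that the entropy of the probability distribution $$\mu_C(\gamma)=\sum_{\alpha\in A,\ \beta\in B,\ \gamma\in\widehat{m}(\alpha,\beta)}\frac{\tau(\alpha,\beta)}{|\widehat{m}(\alpha,\beta)|}$$ is less than the average of the entropies of $\mu_A$ and $\mu_B$.
   Context: The $d$-dimensional hypercube has vertex set $\{0,1\}^d$ with the Hamming distance $d(\cdot,\cdot)$. The symmetric discrete midpoints are $$\widehat{m}(a,b)=\{u: d(a,u)=\lfloor d(a,b)/2\rfloor,\ d(a,u)+d(u,b)=d(a,b)\}\cup\{u: d(a,u)=\lceil d(a,b)/2\rceil,\ d(a,u)+d(u,b)=d(a,b)\}.$$ A transportation from $\mu_A$ to $\mu_B$ is a nonnegative function $\tau$ with $\mu_A(\alpha)=\sum_\beta\tau(\alpha,\beta)$ and $\mu_B(\beta)=\sum_\alpha\tau(\alpha,\beta)$. It is optimal if it minimizes $W^2(\tau)=\sum_{\alpha,\beta}\tau(\alpha,\beta)d(\alpha,\beta)^2$ among all transportations from $\mu_A$ to $\mu_B$. The entropy of a probability distribution $\mu$ is $\sum_y\mu(y)\ln(1/\mu(y))$. *)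

(* Defs.v *)
From mathcomp Require Import all_boot all_order all_algebra.
From mathcomp Require Import reals exp.

Set Implicit Arguments.
Unset Strict Implicit.
Unset Printing Implicit Defensive.

Import Order.TTheory GRing.Theory Num.Theory.

Local Open Scope ring_scope.

Definition cube (d : nat) := {ffun 'I_d -> bool}.

Definition hamming (d : nat) (a b : cube d) : nat := #|[set i | a i != b i]|.

Definition midpoints (d : nat) (a b : cube d) : {set cube d} :=
  [set u | (hamming a u == (hamming a b)./2) &&
           (hamming a u + hamming u b == hamming a b)%N] :|:
  [set u | (hamming a u == uphalf (hamming a b)) &&
           (hamming a u + hamming u b == hamming a b)%N].

(* A probability distribution on a finite type is given by its mass function. *)
Definition uniform (R : realType) (T : finType) (A : {set T}) (x : T) : R :=
  if x \in A then #|A|%:R^-1 else 0.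

(* Points of mass 0 contribute 0, whatever the value of [ln] there. *)
Definition entropy (R : realType) (T : finType) (mu : T -> R) : R :=
  \sum_y mu y * ln (1 / mu y).

(* The marginal conditions range over the whole cube.  Together with
   nonnegativity they force [tau] to vanish outside the product of the supports
   of [mu] and [nu], so a transportation from [uniform A] to [uniform B] is the
   extension by 0 of a function on A x B. *)
Definition transportation (R : realType) (d : nat) (mu nu : cube d -> R)
    (tau : cube d -> cube d -> R) : Prop :=
  [/\ forall a b, 0 <= tau a b,
      forall a, mu a = \sum_b tau a b
    & forall b, nu b = \sum_a tau a b].

Definition transport_cost (R : realType) (d : nat)
    (tau : cube d -> cube d -> R) : R :=
  \sum_a \sum_b tau a b * (hamming a b)%:R ^+ 2.

Definition optimal_transportation (R : realType) (d : nat)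
    (mu nu : cube d -> R) (tau : cube d -> cube d -> R) : Prop :=
  transportation mu nu tau /\
  forall tau', transportation mu nu tau' ->
    transport_cost tau <= transport_cost tau'.

Definition midpoint_distribution (R : realType) (d : nat) (A B : {set cube d})
    (tau : cube d -> cube d -> R) (c : cube d) : R :=
  \sum_(a in A) \sum_(b in B | c \in midpoints a b)
    tau a b / #|midpoints a b|%:R.

(* Main.v *)
(** Take A = {e_0, ..., e_4} and B = {e_5, ..., e_9}.  All distances between A
    and B equal 2, so every transportation is optimal; choose the one matching
    e_i with e_(i+5).  The midpoints of e_i and e_(i+5) are 0 and e_i + e_(i+5),
    so mu_C has mass 1/2 at 0 and mass 1/10 at five other points.  Its entropy
    is (ln 2 + ln 10) / 2 = ln 20 / 2 < ln 25 / 2 = ln 5. *)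

Require Import Defs.
From mathcomp Require Import all_boot all_order all_algebra.
From mathcomp Require Import reals exp.

Set Implicit Arguments.
Unset Strict Implicit.
Unset Printing Implicit Defensive.

Import Order.TTheory GRing.Theory Num.Theory.

Local Open Scope ring_scope.

(** * Entropy of injectively parametrized distributions *)

(** Points outside the image of [g] have mass 0 and contribute 0; injectivity of [g] keeps any point
    from being counted twice. *)
Lemma entropy_inj (R : realType) (I T : finType) (g : I -> T) (mu : T -> R) :
  injective g -> (forall y, y \notin codom g -> mu y = 0) ->
  entropy mu = \sum_i mu (g i) * ln (1 / mu (g i)).
Proof.
move=> g_inj mu0; rewrite /entropy (bigID (mem (codom g))) /=.
rewrite [X in _ + X]big1 ?addr0; last by move=> y /mu0 ->; rewrite mul0r.
rewrite -(big_uniq (codom g)) /=; first by rewrite big_image.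
by rewrite map_inj_uniq // enum_uniq.
Qed.

Lemma uniform_imset (R : realType) (I T : finType) (g : I -> T) (i : I) :
  injective g -> uniform R (g @: setT) (g i) = #|I|%:R^-1.
Proof.
by move=> g_inj; rewrite /uniform imset_f ?inE // card_imset // cardsT.
Qed.

Lemma entropy_uniform_imset (R : realType) (I T : finType) (g : I -> T) :
  injective g -> (0 < #|I|)%N -> entropy (uniform R (g @: setT)) = ln #|I|%:R.
Proof.
move=> g_inj I_gt0; rewrite (entropy_inj g_inj) => [|y yNg]; last first.
  rewrite /uniform ifN //; apply: contra yNg => /imsetP[i _ ->].
  exact: codom_f.
under eq_bigr do rewrite uniform_imset //.
by rewrite sumr_const -[LHS]mulr_natl mulrA mulfV ?mul1r ?invrK // pnatr_eq0 -lt0n.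
Qed.

(** * Transportations between equidistant sets, and matchings *)

Section Transportation.
Variables (R : realType) (d : nat).
Implicit Types (A B : {set cube d}) (tau : cube d -> cube d -> R).

Lemma transportation_uniform_eq0 A B tau a b :
  transportation (uniform R A) (uniform R B) tau ->
  (a \notin A) || (b \notin B) -> tau a b = 0.
Proof.
case=> tau_ge0 tauA tauB /orP[aNA|bNB].
  have /esym/eqP := tauA a; rewrite /uniform ifN // psumr_eq0 //.
  by move/allP/(_ b); rewrite mem_index_enum => /(_ isT)/eqP.
have /esym/eqP := tauB b; rewrite /uniform ifN // psumr_eq0 //.
by move/allP/(_ a); rewrite mem_index_enum => /(_ isT)/eqP.
Qed.

(** Mass moves only between points of [A] and [B], so the cost is [n ^ 2] times the total mass,
    which is 1 because [A] is nonempty. *)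
Lemma transport_cost_equidistant A B n tau :
  A != set0 -> {in A & B, forall a b, hamming a b = n} ->
  transportation (uniform R A) (uniform R B) tau ->
  transport_cost tau = n%:R ^+ 2.
Proof.
move=> A0 dAB tauP; have [_ tauA _] := tauP.
transitivity (\sum_a \sum_b tau a b * n%:R ^+ 2).
  apply: eq_bigr => a _; apply: eq_bigr => b _.
  have [/andP[aA bB]|] := boolP ((a \in A) && (b \in B)); first by rewrite dAB.
  by rewrite negb_and => /(transportation_uniform_eq0 tauP)->; rewrite !mul0r.
under eq_bigr do rewrite -mulr_suml -tauA.
rewrite -mulr_suml /uniform -big_mkcond /= sumr_const -[_^-1 *+ _]mulr_natl.
by rewrite mulfV ?mul1r // pnatr_eq0 cards_eq0.
Qed.

Lemma optimal_equidistant A B n tau :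
  A != set0 -> {in A & B, forall a b, hamming a b = n} ->
  transportation (uniform R A) (uniform R B) tau ->
  optimal_transportation (uniform R A) (uniform R B) tau.
Proof.
move=> A0 dAB tauP; split=> // tau' tau'P.
by rewrite !(transport_cost_equidistant A0 dAB).
Qed.

Variables (I : finType) (e f : I -> cube d).
Hypotheses (e_inj : injective e) (f_inj : injective f).

(** Writing the matching as a sum of point masses at the pairs [(e i, f i)] avoids inverting [e] and
    [f], and makes both marginals an exchange of sums. *)
Definition matching (a b : cube d) : R :=
  \sum_i if (a == e i) && (b == f i) then #|I|%:R^-1 else 0.

Lemma matchingE i j :
  matching (e i) (f j) = if i == j then #|I|%:R^-1 else 0.
Proof.
rewrite /matching (bigD1 i) //= eqxx (inj_eq f_inj) eq_sym big1 ?addr0 //.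
by move=> l li; rewrite (inj_eq e_inj) [i == l]eq_sym (negPf li).
Qed.

Lemma transportation_matching :
  transportation (uniform R (e @: setT)) (uniform R (f @: setT)) matching.
Proof.
(* Uniform measures are put in the same form, a sum of point masses indexed by [I], so that
   marginals compare term by term. *)
have uniform_sum (g : I -> cube d) x : injective g ->
    uniform R (g @: setT) x = \sum_i if x == g i then #|I|%:R^-1 else 0.
  move=> g_inj; have [/imsetP[i _ ->]|xNg] := boolP (x \in g @: setT).
    rewrite uniform_imset // (bigD1 i) //= eqxx big1 ?addr0 // => j ji.
    by rewrite (inj_eq g_inj) eq_sym (negPf ji).
  rewrite /uniform ifN // big1 // => i _; case: eqP => // xE.
  by rewrite xE imset_f in xNg.
split=> [a b|a|b]; rewrite ?uniform_sum //.
- by apply: sumr_ge0 => i _; case: ifP; rewrite // invr_ge0.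
- rewrite exchange_big; apply: eq_bigr => i _ /=.
  case: eqP => _ /=; last by rewrite big1.
  by rewrite -big_mkcond big_pred1_eq.
- rewrite exchange_big; apply: eq_bigr => i _ /=.
  under eq_bigr do rewrite andbC; case: eqP => _ /=; last by rewrite big1.
  by rewrite -big_mkcond big_pred1_eq.
Qed.

(** After reindexing [A] by [e] and [B] by [f], only the diagonal pairs carry mass. *)
Lemma midpoint_distribution_matching c :
  midpoint_distribution (e @: setT) (f @: setT) matching c =
  \sum_(i | c \in midpoints (e i) (f i))
     #|I|%:R^-1 / #|midpoints (e i) (f i)|%:R.
Proof.
rewrite /midpoint_distribution big_imset /=; last by move=> ? ? _ _ /e_inj.
rewrite [RHS]big_mkcond; apply: eq_big => [i|i _]; rewrite ?in_setT //.
rewrite big_imset_cond /=; last by move=> ? ? _ _ /f_inj.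
rewrite big_mkcond (bigD1 i) //= in_setT /= matchingE eqxx big1 ?addr0 // => j ji.
by rewrite matchingE eq_sym (negPf ji) mul0r if_same.
Qed.

End Transportation.

(** * Vertices as subsets, and midpoints of two unit vectors *)

Section Indicators.
Variable d : nat.
Implicit Types (S T : {set 'I_d}) (x y : 'I_d).

Definition indicator S : cube d := [ffun i => i \in S].

Lemma indicator_inj : injective indicator.
Proof. by move=> S T /ffunP ST; apply/setP=> i; have := ST i; rewrite !ffunE. Qed.

Lemma hamming_indicator S T :
  hamming (indicator S) (indicator T) = #|(S :\: T) :|: (T :\: S)|.
Proof.
apply: eq_card => i; rewrite !inE !ffunE.
by case: (i \in S); case: (i \in T).
Qed.

Lemma hamming_indicator1 x y :
  x != y -> hamming (indicator [set x]) (indicator [set y]) = 2%N.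
Proof.
move=> xy; have <-: #|[set x; y]| = 2%N by rewrite cards2 xy.
rewrite hamming_indicator; apply: eq_card => i; rewrite !inE.
by have [->|] := eqVneq i x; rewrite ?(negPf xy) ?andbF.
Qed.

(* A coordinate where [a] and [b] agree but [u] differs would be counted twice
   in [hamming a u + hamming u b]. *)
Lemma between_agree (a b u : cube d) i :
  (hamming a u + hamming u b = hamming a b)%N -> a i = b i -> u i = a i.
Proof.
move=> uE abi; apply/eqP; apply: contraTT isT => uai.
suff: (hamming a b < hamming a u + hamming u b)%N by rewrite uE ltnn.
rewrite -cardsUI -addn1 leq_add //.
  apply/subset_leq_card/subsetP => j; rewrite !inE.
  by case: (a j); case: (b j); case: (u j).
by apply/card_gt0P; exists i; rewrite !inE -abi uai eq_sym uai.
Qed.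

(** The distance is 2, so both roundings of its half are 1. A midpoint vanishes off [x] and [y],
    where both endpoints do, and its values at [x] and [y] agree, since otherwise it would be an
    endpoint. *)
Lemma midpoints_indicator1 x y : x != y ->
  midpoints (indicator [set x]) (indicator [set y]) =
  [set indicator set0; indicator [set x; y]].
Proof.
move=> xy; have yx : y != x by rewrite eq_sym.
apply/setP => u; rewrite !inE hamming_indicator1 //= orbb.
apply/idP/idP => [/andP[/eqP xu /eqP uE]|].
  have uN i : i != x -> i != y -> u i = false.
    move: uE; rewrite -(hamming_indicator1 xy) => uE ix iy.
    rewrite (between_agree uE) !ffunE !inE.
      by rewrite (negPf ix).
    by rewrite (negPf ix) (negPf iy).
  have uxy : u x = u y.
    case ux: (u x); case uy: (u y) => //.
      suff uI : u = indicator [set x].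
        by move: xu; rewrite uI hamming_indicator setDv setU0 cards0.
      apply/ffunP=> i; rewrite !ffunE inE.
      have [->//|ix] := eqVneq i x; have [->//|iy] := eqVneq i y.
      exact: uN.
    suff uI : u = indicator [set y].
      by move: xu; rewrite uI hamming_indicator1.
    apply/ffunP=> i; rewrite !ffunE inE.
    have [->//|iy] := eqVneq i y; have [->//|ix] := eqVneq i x.
    exact: uN.
  (* The common value at [x] and [y] decides between [[set x; y]] and the empty set. *)
  apply/orP; case ux: (u x); [right|left]; apply/eqP/ffunP=> i;
    rewrite !ffunE !inE; have [->|ix] := eqVneq i x; rewrite ?ux //;
    by have [->|iy] := eqVneq i y; rewrite -?uxy ?ux ?uN.
case/orP=> /eqP->; rewrite !hamming_indicator.
  by rewrite !setD0 !set0D setU0 set0U !cards1.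
have -> : ([set x] :\: [set x; y]) :|: ([set x; y] :\: [set x]) = [set y].
  apply/setP=> i; rewrite !inE.
  by have [->|_] := eqVneq i y; rewrite ?(negPf yx) //; case: eqP.
have -> : ([set x; y] :\: [set y]) :|: ([set y] :\: [set x; y]) = [set x].
  apply/setP=> i; rewrite !inE.
  by have [->|_] := eqVneq i x; rewrite ?(negPf xy) //; case: eqP.
by rewrite !cards1.
Qed.

End Indicators.

(** * Matching two disjoint families of unit vectors *)

Section MatchedSingletons.
Variables (R : realType) (d : nat) (I : finType) (x y : I -> 'I_d).
Hypotheses (x_inj : injective x) (y_inj : injective y).
Hypotheses (xy : forall i j, x i != y j) (I_gt0 : (0 < #|I|)%N).

Let e i := indicator [set x i].
Let f i := indicator [set y i].
Let mu := midpoint_distribution (e @: setT) (f @: setT) (matching R e f).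

Lemma indicator1_inj (z : I -> 'I_d) :
  injective z -> injective (fun i => indicator [set z i]).
Proof. by move=> z_inj i j /indicator_inj/set1_inj/z_inj. Qed.

Let e_inj : injective e := indicator1_inj x_inj.
Let f_inj : injective f := indicator1_inj y_inj.

(** All midpoints, listed once each: [None] is the zero vertex shared by every pair, [Some i] the
    midpoint belonging to pair [i] alone. *)
Let mid (o : option I) : cube d :=
  if o is Some i then indicator [set x i; y i] else indicator set0.

Lemma mid_inj : injective mid.
Proof.
have set2N0 i : [set x i; y i] != set0.
  by apply/set0Pn; exists (x i); rewrite !inE eqxx.
case=> [i|] [j|] //= /indicator_inj ijE.
- have: x i \in [set x j; y j] by rewrite -ijE !inE eqxx.
  by rewrite !inE (negPf (xy _ _)) orbF => /eqP/x_inj->.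
- by have := set2N0 i; rewrite ijE eqxx.
- by have := set2N0 j; rewrite -ijE eqxx.
Qed.

Lemma midpoint_distribution_singletons c :
  mu c = \sum_(i | (c == mid None) || (c == mid (Some i))) (#|I|%:R^-1 / 2).
Proof.
rewrite /mu midpoint_distribution_matching //; apply: eq_big => [i|i _].
  by rewrite midpoints_indicator1 // !inE.
(* The denominator is 2 because the two midpoints of a pair are distinct, by [mid_inj]. *)
rewrite midpoints_indicator1 // cards2.
by rewrite (inj_eq mid_inj None (Some i)).
Qed.

(** With n the size of [I], half of the mass sits at zero and the other half is spread evenly over n
    points, giving (ln 2 + ln (2n)) / 2. *)
Lemma midpoint_entropy_singletons : entropy mu = ln (4 * #|I|%:R) / 2.
Proof.
have I_neq0 : #|I|%:R != 0 :> R by rewrite pnatr_eq0 -lt0n.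
rewrite (entropy_inj mid_inj) => [|c cNmid]; last first.
  rewrite midpoint_distribution_singletons big_pred0 // => i.
  by apply: contraNF cNmid => /orP[]/eqP->; apply: codom_f.
have mu0 : mu (mid None) = 2^-1.
  rewrite midpoint_distribution_singletons eqxx sumr_const -[LHS]mulr_natl mulrA.
  by rewrite mulfV // mul1r.
have muS i : mu (mid (Some i)) = #|I|%:R^-1 / 2.
  rewrite midpoint_distribution_singletons (big_pred1 i) // => j.
  by rewrite !(inj_eq mid_inj) /= eq_sym.
pose p : R := #|I|%:R^-1 / 2.
rewrite (bigD1 None) //= mu0 (eq_bigr (fun=> p * ln (1 / p))); last first.
  by case=> // i _; rewrite muS.
rewrite sumr_const cardC1 card_option /p -[X in _ + X]mulr_natl !mulrA mulfV // !mul1r invfM !invrK.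
rewrite -mulrDr -lnM ?posrE ?mulr_gt0 ?ltr0n //.
by rewrite mulrC mulrCA -!natrM mulnC.
Qed.

Lemma optimal_matching_singletons :
  optimal_transportation (uniform R (e @: setT)) (uniform R (f @: setT))
    (matching R e f).
Proof.
apply: (@optimal_equidistant _ _ _ _ 2).
- by rewrite -card_gt0 card_imset // cardsT.
- by move=> _ _ /imsetP[i _ ->] /imsetP[j _ ->]; rewrite hamming_indicator1.
- exact: transportation_matching.
Qed.

(** With n the size of [I], both sides are halves of logarithms, of 4n and of n * n, so the
    inequality amounts to 4 < n. *)
Lemma midpoint_entropy_lt : (4 < #|I|)%N ->
  entropy mu < (entropy (uniform R (e @: setT)) +
                entropy (uniform R (f @: setT))) / 2.
Proof.
move=> I_gt4; rewrite midpoint_entropy_singletons !entropy_uniform_imset //.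
rewrite ltr_pM2r ?invr_gt0 ?ltr0n // -lnM ?posrE ?ltr0n //.
by rewrite ltr_ln ?posrE ?mulr_gt0 ?ltr0n // ltr_pM2r ?ltr0n // ltr_nat.
Qed.

End MatchedSingletons.

Theorem mainTheorem9 (R : realType) (d : nat) (hd : (10 <= d)%N) :
  exists A B : {set cube d},
    [/\ A != set0,
        B != set0
      & exists tau : cube d -> cube d -> R,
          optimal_transportation (uniform R A) (uniform R B) tau /\
          entropy (midpoint_distribution A B tau)
            < (entropy (uniform R A) + entropy (uniform R B)) / 2].
Proof.
(* Five is the least size above 4. The first ten coordinates are split as 5 + 5: [x] takes 0 to 4
   and [y] takes 5 to 9. *)
pose x (i : 'I_5) : 'I_d := widen_ord hd (lshift 5 i).
pose y (i : 'I_5) : 'I_d := widen_ord hd (rshift 5 i).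
have x_inj : injective x by move=> i j /(congr1 val) ij; apply: val_inj.
have y_inj : injective y by move=> i j /(congr1 val)/addnI ij; apply: val_inj.
have xy i j : x i != y j.
  by rewrite -val_eqE /= neq_ltn (leq_trans (ltn_ord i)) ?leq_addr.
have imset_neq0 (g : 'I_5 -> cube d) : g @: setT != set0.
  by apply/set0Pn; exists (g ord0); rewrite imset_f.
exists ((fun i => indicator [set x i]) @: setT).
exists ((fun i => indicator [set y i]) @: setT).
split=> //; exists (matching R (fun i => indicator [set x i])
                               (fun i => indicator [set y i])); split.
  by apply: optimal_matching_singletons; rewrite ?card_ord.
by apply: midpoint_entropy_lt; rewrite ?card_ord.
Qed.
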